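(* Let $K=K_1\times\dots\times K_n$, where $K_j\subseteq\mathbb{R}^{n_j}$ is the ice-cream cone, let $A_j\in\mathbb{R}^{m\times n_j}$, $c_j\in\mathbb{R}^{n_j}$ for $j=1,\dots,n$, and $b\in\mathbb{R}^m$. Consider the second order cone program: minimize $\sum_{j=1}^n c_j^Tx_j$ subject to $\sum_{j=1}^nA_jx_j=b$, $x_j\in K_j$ for $j=1,\dots,n$, with optimal value $\hat f_p$, and its dual: maximize $b^Ty$ subject to $-A_j^Ty+c_j\in K_j$ for $j=1,\dots,n$, $y\in\mathbb{R}^m$, with optimal value $\hat f_d$. Assume that the primal boundedness qualification (PBQ) holds for some $\overline{x}=(\overline{x}_1;\dots;\overline{x}_n)\in K$ with $\overline{x}_{:,j}=0$ and $\overline{x}_{n_j,j}>0$ for every $j$. Let $\tilde y\in\mathbb{R}^m$, and let $d_j:=-A_j^T\tilde y+c_j$ for $j=1,\dots,n$. Suppose further that for $j=1,\dots,n$ there are lower bounds $\underline{d}_j^-\le d_j^-$. Then: (a) The primal optimal value is bounded from below by $$\hat f_p\ \ge\ b^T\tilde y+\sum_{j=1}^n\underline{d}^-_{n_j,j}\,\overline{x}_{n_j,j}=:\underline{f}_p.$$ (b) If $d_{n_j,j}\ge\|d_{:,j}\|$ for $j=1,\dots,n$, then $\tilde y$ is dual feasible and $\hat f_d\ge\underline{f}_p=b^T\tilde y$, and if moreover $\tilde y$ is optimal (for the dual), then $\hat f_d=\underline{f}_p$.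
   Context: For $x\in\mathbb{R}^k$ write $x=(x_:;x_k)$ with $x_:=(x_1,\dots,x_{k-1})^T$; the ice-cream cone in $\mathbb{R}^k$ is $\{x: x_k\ge\|x_:\|\}$ (Euclidean norm). For a block vector $x=(x_1;\dots;x_n)$ with $x_j\in\mathbb{R}^{n_j}$, $x_{i,j}$ is the $i$-th component of $x_j$ and $x_{:,j}=(x_{1,j},\dots,x_{n_j-1,j})^T$; the same notation is used for $d$, $\underline{d}^-$, $\overline{x}$. Vectors in $\mathbb{R}^{n_j}$ (resp. block vectors) are ordered by $u\le v:\Leftrightarrow v-u\in K_j$ (resp. $v-u\in K$). For $x\in\mathbb{R}^k$ the vector $x^-$ (written $\inf\{x,0\}$ in the paper) is given by $$x^-=\begin{cases}x & \text{if } x_k\le-\|x_:\|,\\ 0&\text{if }x_k\ge\|x_:\|,\\ -\dfrac{\|x_:\|-x_k}{2\|x_:\|}\begin{pmatrix}-x_:\\ \|x_:\|\end{pmatrix}&\text{if }-\|x_:\|<x_k<\|x_:\|.\end{cases}$$ $\hat f_p$ is the primal optimal value ($+\infty$ if the primal is infeasible); $\hat f_d$ is the dual optimal value ($-\infty$ if the dual is infeasible). PBQ (with bound $\overline{x}$): either (i) the primal problem is infeasible, or (ii) $\hat f_p$ is finite and the simple bound $\overline{x}\in K$ is such that for every $\varepsilon>0$ there exists a primal feasible solution $x(\varepsilon)$ with $x(\varepsilon)\le\overline{x}$ and $\sum_{j=1}^n c_j^Tx_j(\varepsilon)-\hat f_p\le\varepsilon$.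
   Formalization: In (b), the equalities of the lower bound with b^T ỹ and with the dual optimal value are stated only when each lower bound equals d_j^- (which is 0 there); for other lower bounds they fail. With arbitrary bounds, the dual value is still shown to be at least the bound, and to equal b^T ỹ if ỹ is optimal. *)

(* Defs.v *)
From HB Require Import structures.
From mathcomp Require Import all_boot all_order all_algebra.
From mathcomp Require Import all_classical all_reals ereal.

Set Implicit Arguments.
Unset Strict Implicit.
Unset Printing Implicit Defensive.

Import Order.TTheory GRing.Theory Num.Theory.
Local Open Scope classical_set_scope.
Local Open Scope ring_scope.

Section Vectors.
Variable R : realType.

Definition dotc (p : nat) (u v : 'cV[R]_p) : R := (u^T *m v) 0 0.

(* Euclidean norm; the canonical norm `|u| on matrices is the sup norm. *)
Definition enorm (p : nat) (u : 'cV[R]_p) : R := Num.sqrt (dotc u u).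

(* The paper's x = (x_: ; x_k) in R^k, k >= 1, is col_mx x_: x_k of type
   'cV_(p + 1) with p = k - 1. *)
Definition vhead (p : nat) (x : 'cV[R]_(p + 1)) : 'cV[R]_p := usubmx x.
Definition vlast (p : nat) (x : 'cV[R]_(p + 1)) : R := dsubmx x 0 0.

Definition icecream (p : nat) : set 'cV[R]_(p + 1) :=
  [set x | enorm (vhead x) <= vlast x].

Definition cone_le (p : nat) (u v : 'cV[R]_(p + 1)) : Prop :=
  icecream (v - u).

(* x^- = inf{x, 0}. The first two branches overlap only at x = 0. *)
Definition neg_part (p : nat) (x : 'cV[R]_(p + 1)) : 'cV[R]_(p + 1) :=
  let h := enorm (vhead x) in
  if vlast x <= - h then x
  else if h <= vlast x then 0
  else - ((h - vlast x) / (2 * h)) *: col_mx (- vhead x) h%:M.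

End Vectors.

(* Block vectors (x_1; ...; x_n) whose j-th block lies in R^(n_j),
   with n_j = k j + 1. *)
Definition block_vec (R : realType) (n : nat) (k : 'I_n -> nat) : Type :=
  forall j : 'I_n, 'cV[R]_(k j + 1).

Section SecondOrderConeProgram.
Variables (R : realType) (m n : nat) (k : 'I_n -> nat).
Variables (A : forall j : 'I_n, 'M[R]_(m, k j + 1)) (b : 'cV[R]_m).
Variable c : block_vec R k.

Definition cone_prod : set (block_vec R k) :=
  [set x | forall j, icecream (x j)].

Definition block_le (u v : block_vec R k) : Prop :=
  cone_prod (fun j => v j - u j).

Definition primal_obj (x : block_vec R k) : R := \sum_(j < n) dotc (c j) (x j).

Definition primal_feasible : set (block_vec R k) :=
  [set x | \sum_(j < n) A j *m x j = b /\ cone_prod x].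

Definition primal_value : \bar R :=
  ereal_inf [set (primal_obj x)%:E | x in primal_feasible].

Definition dual_slack (y : 'cV[R]_m) : block_vec R k :=
  fun j => - (A j)^T *m y + c j.

Definition dual_feasible : set 'cV[R]_m := [set y | cone_prod (dual_slack y)].

Definition dual_value : \bar R :=
  ereal_sup [set (dotc b y)%:E | y in dual_feasible].

Definition dual_optimal (y : 'cV[R]_m) : Prop :=
  dual_feasible y /\ forall z, dual_feasible z -> dotc b z <= dotc b y.

(* Primal boundedness qualification with bound xbar. *)
Definition PBQ (xbar : block_vec R k) : Prop :=
  primal_feasible = set0 \/
  [/\ primal_value \is a fin_num, cone_prod xbar &
      forall eps : R, 0 < eps ->
        exists x, [/\ primal_feasible x, block_le x xbar &
                      ((primal_obj x)%:E - primal_value <= eps%:E)%E]].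

End SecondOrderConeProgram.

(* Main.v *)
Require Import Defs.
From mathcomp Require Import all_boot all_order all_algebra.
From mathcomp Require Import all_classical all_reals ereal.
From mathcomp Require Import ring lra.

Set Implicit Arguments.
Unset Strict Implicit.
Unset Printing Implicit Defensive.

Import Order.TTheory GRing.Theory Num.Theory.
Local Open Scope ring_scope.

(** The bound is weak duality with a controlled defect. For a primal feasible
    [x], the objective equals [dotc b y] plus the sum over the blocks of
    [dotc (d j) (x j)], where [d] is the dual slack of [y]. When [y] is not dual
    feasible these terms may be negative, but the Moreau decomposition
    [d j = (d j - d^-) + d^-], with [d j - d^-] and [- d^-] both in the cone,
    controls them. Self-duality of the ice-cream cone, i.e. nonnegativity of
    [dotc] on pairs of cone elements ([icecream_dotc_ge0], which is
    Cauchy-Schwarz), is used three times in [dotc_neg_part_bound]: when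
    [0 <= x <= xbar] in the cone order and [dlow <= d^-],

      [<d, x> >= <d^-, x> >= <d^-, xbar> >= <dlow, xbar>],

    and the last pairing is a product of last components since [xbar] lies on
    the axis of the cone. The boundedness qualification supplies feasible points
    below [xbar] with objective arbitrarily close to the primal value, so the
    bound passes to the infimum.

    When every slack block lies in the cone, [y] is itself dual feasible and the
    correction terms are nonpositive; they vanish for the sharp choice
    [dlow = d^-], because the negative part of a cone element is zero. *)

(** * The Euclidean inner product *)

Section InnerProduct.
Variable R : realType.

Lemma dotcE p (u v : 'cV[R]_p) : dotc u v = \sum_i u i 0 * v i 0.
Proof. by rewrite /dotc mxE; apply: eq_bigr => i _; rewrite mxE. Qed.

Lemma dotcC p (u v : 'cV[R]_p) : dotc u v = dotc v u.
Proof. by rewrite !dotcE; apply: eq_bigr => i _; rewrite mulrC. Qed.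

Lemma dotcDl p (u v w : 'cV[R]_p) : dotc (u + v) w = dotc u w + dotc v w.
Proof. by rewrite /dotc linearD mulmxDl mxE. Qed.

Lemma dotcDr p (u v w : 'cV[R]_p) : dotc w (u + v) = dotc w u + dotc w v.
Proof. by rewrite ![dotc w _]dotcC dotcDl. Qed.

Lemma dotcZl p a (u v : 'cV[R]_p) : dotc (a *: u) v = a * dotc u v.
Proof. by rewrite /dotc linearZ -scalemxAl mxE. Qed.

Lemma dotcZr p a (u v : 'cV[R]_p) : dotc u (a *: v) = a * dotc u v.
Proof. by rewrite dotcC dotcZl dotcC. Qed.

Lemma dotcNl p (u v : 'cV[R]_p) : dotc (- u) v = - dotc u v.
Proof. by rewrite -scaleN1r dotcZl mulN1r. Qed.

Lemma dotcNr p (u v : 'cV[R]_p) : dotc u (- v) = - dotc u v.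
Proof. by rewrite dotcC dotcNl dotcC. Qed.

Lemma dotc_mulmx p q (M : 'M[R]_(p, q)) (x : 'cV_q) (y : 'cV_p) :
  dotc (M^T *m y) x = dotc y (M *m x).
Proof. by rewrite /dotc trmx_mul trmxK mulmxA. Qed.

Lemma dotc_sumr p n (y : 'cV[R]_p) (F : 'I_n -> 'cV[R]_p) :
  dotc y (\sum_j F j) = \sum_j dotc y (F j).
Proof. by rewrite /dotc mulmx_sumr summxE. Qed.

Lemma dotc_ge0 p (u : 'cV[R]_p) : 0 <= dotc u u.
Proof. by rewrite dotcE sumr_ge0 // => i _; rewrite -expr2 sqr_ge0. Qed.

Lemma dotc_eq0 p (u : 'cV[R]_p) : dotc u u = 0 -> u = 0.
Proof.
move=> /eqP; rewrite dotcE psumr_eq0 => [/allP u0|i _]; last first.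
  by rewrite -expr2 sqr_ge0.
apply/colP => i; rewrite mxE; apply/eqP.
by have := u0 i (mem_index_enum _); rewrite /= mulf_eq0 orbb.
Qed.

Lemma enorm_ge0 p (u : 'cV[R]_p) : 0 <= enorm u.
Proof. exact: sqrtr_ge0. Qed.

Lemma sqr_enorm p (u : 'cV[R]_p) : enorm u ^+ 2 = dotc u u.
Proof. by rewrite sqr_sqrtr // dotc_ge0. Qed.

Lemma enorm_eq0 p (u : 'cV[R]_p) : enorm u = 0 -> u = 0.
Proof. by move=> u0; apply: dotc_eq0; rewrite -sqr_enorm u0 expr0n. Qed.

Lemma enorm0 p : enorm (0 : 'cV[R]_p) = 0.
Proof. by rewrite /enorm -(scale0r 0) dotcZl mul0r sqrtr0. Qed.

Lemma enormZ p a (u : 'cV[R]_p) : enorm (a *: u) = `|a| * enorm u.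
Proof.
by rewrite /enorm dotcZl dotcZr mulrA -expr2 sqrtrM ?sqr_ge0 // sqrtr_sqr.
Qed.

Lemma enormN p (u : 'cV[R]_p) : enorm (- u) = enorm u.
Proof. by rewrite -scaleN1r enormZ normrN1 mul1r. Qed.

(** The Cauchy-Schwarz inequality, in its lower form: expand the squared norm
    of [enorm v *: u + enorm u *: v] and divide by [enorm u * enorm v]. *)
Lemma dotc_ge_enorm p (u v : 'cV[R]_p) : - (enorm u * enorm v) <= dotc u v.
Proof.
have [/enorm_eq0 ->|u_neq0] := eqVneq (enorm u) 0.
  by rewrite enorm0 mul0r oppr0 -(scale0r 0) dotcZl mul0r.
have [/enorm_eq0 ->|v_neq0] := eqVneq (enorm v) 0.
  by rewrite enorm0 mulr0 oppr0 -(scale0r 0) dotcZr mul0r.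
have uv_gt0 : 0 < enorm u * enorm v.
  by rewrite mulr_gt0 // lt_def enorm_ge0 ?u_neq0 ?v_neq0.
have := dotc_ge0 (enorm v *: u + enorm u *: v).
rewrite !dotcDl !dotcDr !dotcZl !dotcZr -!sqr_enorm (dotcC v u).
set a := enorm u in uv_gt0 *; set b := enorm v in uv_gt0 *.
rewrite [X in 0 <= X -> _](_ : _ = 2 * (a * b) * (a * b + dotc u v));
  last by ring.
by rewrite pmulr_rge0; [move=> ?; lra | exact: mulr_gt0].
Qed.

End InnerProduct.

(** * The ice-cream cone *)

Section IceCream.
Variable R : realType.

Lemma vheadN p (x : 'cV[R]_(p + 1)) : vhead (- x) = - vhead x.
Proof. by rewrite /vhead linearN. Qed.

Lemma vheadB p (x y : 'cV[R]_(p + 1)) : vhead (x - y) = vhead x - vhead y.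
Proof. by rewrite /vhead linearB. Qed.

Lemma vlastN p (x : 'cV[R]_(p + 1)) : vlast (- x) = - vlast x.
Proof. by rewrite /vlast linearN mxE. Qed.

Lemma vlastB p (x y : 'cV[R]_(p + 1)) : vlast (x - y) = vlast x - vlast y.
Proof. by rewrite /vlast linearB !mxE. Qed.

Lemma dotc_head_last p (x y : 'cV[R]_(p + 1)) :
  dotc x y = dotc (vhead x) (vhead y) + vlast x * vlast y.
Proof.
rewrite !dotcE big_split_ord big_ord1 /vlast /vhead !mxE.
by congr (_ + _); apply: eq_bigr => i _; rewrite !mxE.
Qed.

Lemma icecream_last_ge0 p (x : 'cV[R]_(p + 1)) : icecream x -> 0 <= vlast x.
Proof. exact: le_trans (enorm_ge0 _). Qed.

(** Half of the self-duality of the ice-cream cone: the product of the last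
    components dominates the product of the norms of the heads. *)
Lemma icecream_dotc_ge0 p (x y : 'cV[R]_(p + 1)) :
  icecream x -> icecream y -> 0 <= dotc x y.
Proof.
move=> Kx Ky; rewrite dotc_head_last.
have := ler_pM (enorm_ge0 _) (enorm_ge0 _) Kx Ky.
by have := dotc_ge_enorm (vhead x) (vhead y); lra.
Qed.

Lemma icecream0 p : icecream (0 : 'cV[R]_(p + 1)).
Proof. by rewrite /icecream /= /vhead /vlast !linear0 enorm0 mxE. Qed.

(** Outside the cone and its opposite, [x] has eigenvalues of both signs in the
    Jordan algebra of the cone, and [neg_part x] is the negative one,
    [vlast x - enorm (vhead x)], times its idempotent. *)
Lemma neg_part_mid p (x : 'cV[R]_(p + 1)) (h := enorm (vhead x)) :
  - h < vlast x -> vlast x < h ->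
  vhead (neg_part x) = ((h - vlast x) / (2 * h)) *: vhead x /\
  vlast (neg_part x) = - ((h - vlast x) / 2).
Proof.
move=> lo hi; have h_gt0 : 0 < h by lra.
rewrite /neg_part -/h leNgt lo leNgt hi /=; split.
  by rewrite /vhead linearZ /= col_mxKu scalerN scaleNr opprK.
by rewrite /vlast linearZ /= col_mxKd !mxE mulr1n; field; rewrite gt_eqF.
Qed.

Lemma icecream_oppr_neg_part p (x : 'cV[R]_(p + 1)) : icecream (- neg_part x).
Proof.
have [le_xN|lo] := leP (vlast x) (- enorm (vhead x)).
  rewrite /neg_part le_xN /icecream /= vheadN vlastN enormN; lra.
have [ge_x|hi] := leP (enorm (vhead x)) (vlast x).
  rewrite /neg_part leNgt lo ge_x oppr0; exact: icecream0.
have [hE lE] := neg_part_mid lo hi.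
rewrite /icecream /= vheadN vlastN enormN hE lE enormZ.
set h := enorm _ in lo hi *; have h_gt0 : 0 < h by lra.
rewrite ger0_norm ?divr_ge0 //; [|lra..].
by rewrite le_eqVlt; apply/orP; left; apply/eqP; field; rewrite gt_eqF.
Qed.

(** The difference is the positive part of [x]: between the cone and its
    opposite it is the positive eigenvalue [enorm (vhead x) + vlast x] times the
    other idempotent. *)
Lemma neg_part_le p (x : 'cV[R]_(p + 1)) : cone_le (neg_part x) x.
Proof.
rewrite /cone_le; have [le_xN|lo] := leP (vlast x) (- enorm (vhead x)).
  rewrite /neg_part le_xN subrr; exact: icecream0.
have [ge_x|hi] := leP (enorm (vhead x)) (vlast x).
  by rewrite /neg_part leNgt lo ge_x subr0.
have [hE lE] := neg_part_mid lo hi.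
rewrite /icecream /= vheadB vlastB hE lE.
rewrite -{1}[vhead x]scale1r -scalerBl enormZ.
set h := enorm _ in lo hi *; have h_gt0 : 0 < h by lra.
have -> : 1 - (h - vlast x) / (2 * h) = (h + vlast x) / (2 * h).
  by field; rewrite gt_eqF.
rewrite ger0_norm ?divr_ge0 //; [|lra..].
by rewrite le_eqVlt; apply/orP; left; apply/eqP; field; rewrite gt_eqF.
Qed.

Lemma vlast_neg_part_icecream p (x : 'cV[R]_(p + 1)) :
  icecream x -> vlast (neg_part x) = 0.
Proof.
rewrite /icecream /= => Kx; have h_ge0 := enorm_ge0 (vhead x).
rewrite /neg_part Kx; case: ifP => [?|_]; first lra.
by rewrite /vlast linear0 mxE.
Qed.

Lemma vlast_le_neg_part_le0 p (dlow d : 'cV[R]_(p + 1)) :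
  cone_le dlow (neg_part d) -> vlast dlow <= 0.
Proof.
move=> /icecream_last_ge0; rewrite vlastB.
by have := icecream_last_ge0 (icecream_oppr_neg_part d); rewrite vlastN; lra.
Qed.

(** The estimate for one block: each of [d - d^-], [- d^-] and [d^- - dlow] is
    in the cone, and pairs nonnegatively with [x], [xbar - x] and [xbar]. *)
Lemma dotc_neg_part_bound p (d dlow x xbar : 'cV[R]_(p + 1)) :
  icecream xbar -> vhead xbar = 0 -> cone_le dlow (neg_part d) ->
  icecream x -> cone_le x xbar ->
  vlast dlow * vlast xbar <= dotc d x.
Proof.
move=> Kxbar xbar0 dlow_le Kx x_le.
have -> : vlast dlow * vlast xbar = dotc dlow xbar.
  by rewrite dotc_head_last xbar0 -(scale0r 0) dotcZr mul0r add0r.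
have := icecream_dotc_ge0 (neg_part_le d) Kx.
have := icecream_dotc_ge0 (icecream_oppr_neg_part d) x_le.
have := icecream_dotc_ge0 dlow_le Kxbar.
by rewrite !dotcDl !dotcDr !dotcNl !dotcNr; lra.
Qed.

End IceCream.

(** * Weak duality for the second order cone program *)

Section Duality.
Variables (R : realType) (m n : nat) (k : 'I_n -> nat).
Variables (A : forall j : 'I_n, 'M[R]_(m, k j + 1)) (b : 'cV[R]_m).
Variable c : block_vec R k.

Lemma primal_obj_dual_slack (y : 'cV[R]_m) (x : block_vec R k) :
  \sum_(j < n) A j *m x j = b ->
  primal_obj c x = dotc b y + \sum_(j < n) dotc (dual_slack A c y j) (x j).
Proof.
move=> <-; rewrite dotcC dotc_sumr -big_split /primal_obj; apply: eq_bigr => j _.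
by rewrite /= dotcDl mulNmx dotcNl dotc_mulmx addrA subrr add0r.
Qed.

(** The qualification is what turns a bound on the feasible points below [xbar]
    into a bound on the infimum over all of them. *)
Lemma PBQ_primal_value_ge (xbar : block_vec R k) (f : R) :
  PBQ A b c xbar ->
  (forall x, primal_feasible A b x -> block_le x xbar -> f <= primal_obj c x) ->
  (f%:E <= primal_value A b c)%E.
Proof.
case=> [infeas _|[val_fin _ approx] f_le].
  by rewrite /primal_value infeas image_set0 ereal_inf0 leey.
rewrite -(fineK val_fin) lee_fin; apply/ler_addgt0Pr => e e_gt0.
have [x [x_feas x_le]] := approx e e_gt0.
rewrite -(fineK val_fin) -EFinB lee_fin => obj_le.
by have := f_le x x_feas x_le; lra.
Qed.

Lemma dual_feasible_le_value (y : 'cV[R]_m) :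
  dual_feasible A c y -> ((dotc b y)%:E <= dual_value A b c)%E.
Proof. by move=> y_feas; apply: ereal_sup_ubound; exists y. Qed.

Lemma dual_optimal_value (y : 'cV[R]_m) :
  dual_optimal A b c y -> dual_value A b c = (dotc b y)%:E.
Proof.
move=> [y_feas y_max]; apply/eqP; rewrite eq_le dual_feasible_le_value // andbT.
by apply: ge_ereal_sup => _ [z z_feas <-]; rewrite lee_fin y_max.
Qed.

End Duality.

Theorem corollary5p1 (R : realType) (m n : nat) (k : 'I_n -> nat)
    (A : forall j : 'I_n, 'M[R]_(m, k j + 1)) (b : 'cV[R]_m)
    (c : block_vec R k) (xbar : block_vec R k)
    (xbarK : cone_prod xbar)
    (xbar_head : forall j, vhead (xbar j) = 0)
    (xbar_last : forall j, 0 < vlast (xbar j))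
    (pbq : PBQ A b c xbar)
    (ytilde : 'cV[R]_m) (dlow : block_vec R k)
    (dlow_le : forall j, cone_le (dlow j) (neg_part (dual_slack A c ytilde j))) :
  let d := dual_slack A c ytilde in
  let flow := dotc b ytilde + \sum_(j < n) vlast (dlow j) * vlast (xbar j) in
  (* (a) *)
  (flow%:E <= primal_value A b c)%E /\
  (* (b) *)
  ((forall j, enorm (vhead (d j)) <= vlast (d j)) ->
   [/\ dual_feasible A c ytilde,
       (flow%:E <= dual_value A b c)%E,
       ((dotc b ytilde)%:E <= dual_value A b c)%E,
       dual_optimal A b c ytilde -> dual_value A b c = (dotc b ytilde)%:E &
       (* the equality flow = b^T ytilde requires the sharp bounds d^- = 0 *)
       (forall j, dlow j = neg_part (d j)) ->
         flow = dotc b ytilde /\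
         (dual_optimal A b c ytilde -> dual_value A b c = flow%:E)]).
Proof.
move=> d flow; split.
  apply: (PBQ_primal_value_ge pbq) => x [Axb Kx] x_le.
  rewrite (primal_obj_dual_slack c ytilde Axb) lerD2l; apply: ler_sum => j _.
  apply: dotc_neg_part_bound (xbarK j) (xbar_head j) (dlow_le j) (Kx j) _.
  exact: x_le.
move=> dK; have y_feas : dual_feasible A c ytilde by move=> j; exact: dK.
split => //.
- apply: le_trans (dual_feasible_le_value b y_feas).
  rewrite lee_fin gerDl; apply: sumr_le0 => j _.
  by apply: mulr_le0_ge0; [exact: vlast_le_neg_part_le0 (dlow_le j) | exact: ltW].
- exact: dual_feasible_le_value.
- exact: dual_optimal_value.
- move=> dlowE; have flowE : flow = dotc b ytilde.
    rewrite /flow big1 ?addr0 // => j _.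
    by rewrite dlowE vlast_neg_part_icecream ?mul0r //; exact: dK.
  by split => // /dual_optimal_value; rewrite flowE.
Qed.
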